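(* Let $p$ be a prime with $p\equiv5$ or $7\pmod 8$. Then $S_{\frac{p^2-1}{2}}\equiv0\pmod{p^2}$ and $f_{\frac{p^2-1}{2}}\equiv0\pmod{p^2}$.
   Context: $(S_n)_{n\ge0}$ is the integer sequence defined by $S_0=1$, $S_1=4$ and $(n+1)^2S_{n+1}=4(3n^2+3n+1)S_n-32n^2S_{n-1}$ for $n\ge1$; equivalently $S_n=\sum_{k=0}^n\binom nk\binom{2k}k\binom{2n-2k}{n-k}$. The Franel numbers are $f_n=\sum_{k=0}^n\binom nk^3$. *)

(* Defs.v *)
From mathcomp Require Import all_boot.
Set Implicit Arguments. Unset Strict Implicit. Unset Printing Implicit Defensive.

(* S_n = sum_{k=0}^n C(n,k) C(2k,k) C(2n-2k,n-k)  (equivalent to the recurrence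
   definition S_0=1, S_1=4, (n+1)^2 S_{n+1} = 4(3n^2+3n+1) S_n - 32 n^2 S_{n-1}). *)
Definition S (n : nat) : nat :=
  \sum_(0 <= k < n.+1) 'C(n, k) * 'C(2 * k, k) * 'C(2 * n - 2 * k, n - k).

Definition franel (n : nat) : nat := \sum_(0 <= k < n.+1) 'C(n, k) ^ 3.

(* Main.v *)
Require Import Defs.
From mathcomp Require Import all_boot.
From mathcomp Require Import all_order all_algebra zify ring.
Import Order.TTheory GRing.Theory Num.Theory.

(* With n = (p^2 - 1)/2 = 2 N, binomial identities give
   S_n = 4^n sum_k s_k and f_n = 2^n sum_k s_k prod_{j<k} (1 + p^2/(2j+1)), where
   s_k = (1/2)_k (-N)_k (1/2 - N)_k / k!^3.  Moreover
   w(N) = sum_k (1/2)_k (-N)_k (N+1)_k / k!^3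
        = sum_k s_k prod_{j<k} (1 + p^2/(2j+1-2N)),
   and w has a closed form: it vanishes at odd arguments, and
   w(2m) = (binomial(2m, m) / 4^m)^2.  For p = 5, 7 mod 8 we have N = 2m with p
   dividing binomial(2m, m), so w(N) = 0 mod p^2.  The factors 1 + p^2/x differ
   from 1 modulo p^2 only when p | x, and then only by a multiple of p, whose
   coefficient is a sum of full blocks of p consecutive s_k.  Modulo p such a
   block is a multiple of w(M) with M = floor(p/4), which is zero as M is odd.
   Hence all three sums agree modulo p^2. *)

(** * Binomial identities and single-sum forms of [S] and [franel] *)

Lemma sum_truncate (n m : nat) (F : nat -> nat) : n <= m ->
  (forall i, n <= i -> F i = 0) -> \sum_(i < m) F i = \sum_(i < n) F i.
Proof.
move=> le_nm F0; rewrite (big_ord_widen _ F le_nm) [RHS]big_mkcond.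
by apply: eq_bigr => i _; case: ltnP => // /F0.
Qed.

Lemma sum_shift (a m : nat) (F : nat -> nat) : a <= m ->
  (forall i, i < a -> F i = 0) -> \sum_(i < m) F i = \sum_(i < m - a) F (i + a).
Proof.
move=> le_am F0; rewrite -(big_mkord xpredT F) (big_cat_nat (leq0n a) le_am) /=.
rewrite big_nat_cond big1 ?add0n; last by move=> i /andP[/F0].
by rewrite -{1}[a]add0n big_addn big_mkord.
Qed.

(** Vandermonde convolution after the reflection t -> a - t in the first factor. *)
Lemma bin_sum_diag (a b c K : nat) : a < K ->
  \sum_(t < K) 'C(a, t) * 'C(b, t + c) = 'C(a + b, a + c).
Proof.
move=> ltaK; rewrite (@sum_truncate a.+1 K (fun t => 'C(a, t) * 'C(b, t + c))) //;
  last by move=> i lt_ai; rewrite bin_small.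
rewrite -(binomial.Vandermonde a b (a + c)).
rewrite (@sum_truncate a.+1 (a + c).+1 (fun t => 'C(a, t) * 'C(b, a + c - t))).
- rewrite (reindex_inj rev_ord_inj) /=; apply: eq_bigr => i _.
  have := ltn_ord i; rewrite ltnS subSS => le_ia.
  by rewrite bin_sub // addnBAC.
- by rewrite ltnS leq_addr.
- by move=> i lt_ai; rewrite bin_small.
Qed.

Lemma sum_bin_sqr (a K : nat) : a < K -> \sum_(i < K) 'C(a, i) ^ 2 = 'C(2 * a, a).
Proof.
move=> ltaK; transitivity 'C(a + a, a + 0); last by rewrite addn0 addnn mul2n.
by rewrite -(@bin_sum_diag a a 0 K) //; apply: eq_bigr => i _; rewrite addn0.
Qed.

Lemma sum_bin (n K : nat) : n < K -> \sum_(i < K) 'C(n, i) = 2 ^ n.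
Proof.
move=> ltnK; rewrite (@sum_truncate n.+1) //; last by move=> i ?; rewrite bin_small.
rewrite -[2]/(1 + 1) expnDn; apply: eq_bigr => i _.
by rewrite !exp1n !muln1.
Qed.

(** Both sides are the multinomial coefficient (a+b+c+d)! / (a! b! c! d!), split along the columns
    or along the rows of a 2 x 2 table. *)
Lemma bin_tetranomial (a b c d : nat) :
  'C(a + b + (c + d), a + c) * 'C(a + c, a) * 'C(b + d, b) =
  'C(a + b + (c + d), a + b) * 'C(a + b, a) * 'C(c + d, c).
Proof.
have F m n : 'C(m + n, m) * (m`! * n`!) = (m + n)`!.
  by rewrite -{2}(addKn m n) bin_fact // leq_addr.
apply/eqP; rewrite -(@eqn_pmul2r (a`! * b`! * (c`! * d`!))); last first.
  by rewrite !muln_gt0 !fact_gt0.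
apply/eqP; transitivity ((a + b + (c + d))`!).
  rewrite [LHS](_ : _ = 'C(a + b + (c + d), a + c) *
    ('C(a + c, a) * (a`! * c`!) * ('C(b + d, b) * (b`! * d`!)))); last by ring.
  by rewrite !F addnACA F.
rewrite [RHS](_ : _ = 'C(a + b + (c + d), a + b) *
    ('C(a + b, a) * (a`! * b`!) * ('C(c + d, c) * (c`! * d`!)))); last by ring.
by rewrite !F.
Qed.

Lemma bin_trinomial (n k a b : nat) : a <= k -> k <= n ->
  'C(n, k) * 'C(k, a) * 'C(n - k, b) =
  'C(n, a + b) * 'C(a + b, a) * 'C(n - (a + b), k - a).
Proof.
move=> le_ak le_kn; case: (leqP b (n - k)) => [le_b | lt_b]; last first.
  rewrite (bin_small lt_b) muln0; case: (leqP (a + b) n) => [? | /bin_small-> //].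
  by rewrite ['C(n - _, _)]bin_small ?muln0 //; lia.
have := bin_tetranomial a b (k - a) (n - k - b).
rewrite (_ : a + b + _ = n); last by lia.
rewrite (_ : a + (k - a) = k); last by lia.
rewrite (_ : b + (n - k - b) = n - k); last by lia.
by rewrite (_ : k - a + (n - k - b) = n - (a + b)); last by lia.
Qed.

(** After regrouping by [bin_trinomial], only 'C(n - (a + b), k - a) depends on k, and it sums to a
    power of 2. *)
Lemma sum_bin_trinomial (n a b : nat) :
  \sum_(k < n.+1) 'C(n, k) * ('C(k, a) * 'C(n - k, b)) =
  'C(n, a + b) * 'C(a + b, a) * 2 ^ (n - (a + b)).
Proof.
case: (leqP (a + b) n) => [le_n | lt_n]; last first.
  rewrite (bin_small lt_n) !mul0n big1 // => -[k lt_k] _ /=.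
  case: (ltnP k a) => [/bin_small-> | le_ak]; first by rewrite mul0n muln0.
  by rewrite ['C(n - k, b)]bin_small ?muln0 //; lia.
rewrite (@sum_shift a n.+1 (fun k => 'C(n, k) * ('C(k, a) * 'C(n - k, b)))); first last.
- by move=> k lt_ka; rewrite (bin_small lt_ka) mul0n muln0.
- lia.
rewrite -(@sum_bin _ (n.+1 - a)); last by lia.
rewrite big_distrr /=; apply: eq_bigr => -[i lt_i] _ /=.
by rewrite mulnA bin_trinomial ?addnK //; lia.
Qed.

(** Both sides are the constant term of (x + 2 + 1/x)^k. In the proof, each term on the right is
    opened by [sum_bin_trinomial]; the inner sum over i is then a Vandermonde sum, which leaves the
    sum of 'C(k, j)^2. *)
Lemma central_bin_sum (k K : nat) : k < K ->
  'C(2 * k, k) = \sum_(i < K) 'C(k, 2 * i) * 'C(2 * i, i) * 2 ^ (k - 2 * i).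
Proof.
move=> ltkK; rewrite -(@sum_bin_sqr k k.+1) //.
under [RHS]eq_bigr => i _ do rewrite mul2n -addnn -sum_bin_trinomial.
rewrite exchange_big; apply: eq_bigr => -[j lt_j] _ /=.
rewrite -big_distrr /= -mulnn.
under eq_bigr => i _ do rewrite -[X in 'C(_ - _, X)]addn0.
by rewrite bin_sum_diag ?addn0 ?subnKC //; lia.
Qed.

Lemma sum_triangle (n : nat) (g : nat -> nat -> nat) :
  (forall i l, n < i + l -> g i l = 0) ->
  \sum_(i < n.+1) \sum_(l < n.+1) g i l =
  \sum_(m < n.+1) \sum_(i < m.+1) g i (m - i).
Proof.
move=> g0; transitivity (\sum_(i < n.+1) \sum_(m < n.+1 | i <= m) g i (m - i)).
  apply: eq_bigr => -[i lt_i] _ /=.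
  rewrite [RHS]big_mkcond /=; symmetry.
  apply: etrans (@sum_shift i n.+1 (fun m => if i <= m then g i (m - i) else 0) _ _) _.
  - exact: ltnW.
  - by move=> k; rewrite ltnNge => /negbTE->.
  rewrite (@sum_truncate (n.+1 - i) n.+1 (g i)) ?leq_subr //; last first.
    by move=> l Hl; apply: g0; lia.
  by apply: eq_bigr => l _; rewrite leq_addl addnK.
rewrite (exchange_big_dep xpredT) //=; apply: eq_bigr => m _.
rewrite [RHS](big_ord_widen n.+1 (fun i => g i (m - i))) //.
Qed.

(** Both central binomials are expanded by [central_bin_sum], which makes the sum over k explicit.
    On the diagonal i + l = m, [bin_tetranomial] turns 'C(2m, 2i) 'C(2i, i) 'C(2l, l) into 'C(2m, m)
    'C(m, i)^2, and the squares sum to a second 'C(2m, m). *)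
Lemma S_formula (n : nat) :
  S n = \sum_(m < n.+1) 'C(2 * m, m) ^ 2 * 'C(n, 2 * m) * 4 ^ (n - 2 * m).
Proof.
pose g i l := 'C(n, 2 * i + 2 * l) * 'C(2 * i + 2 * l, 2 * i) *
  ('C(2 * i, i) * 'C(2 * l, l)) * 4 ^ (n - (2 * i + 2 * l)).
transitivity (\sum_(i < n.+1) \sum_(l < n.+1) g i l).
  rewrite /S big_mkord.
  transitivity (\sum_(k < n.+1) \sum_(i < n.+1) \sum_(l < n.+1)
      ('C(n, k) * ('C(k, 2 * i) * 'C(n - k, 2 * l))) *
      ('C(2 * i, i) * 'C(2 * l, l)) * 2 ^ (n - (2 * i + 2 * l))).
    apply: eq_bigr => -[k lt_k] _ /=.
    rewrite -mulnBr (@central_bin_sum k n.+1) // (@central_bin_sum (n - k) n.+1); last by lia.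
    rewrite -mulnA big_distrlr big_distrr /=; apply: eq_bigr => i _.
    rewrite big_distrr /=; apply: eq_bigr => l _.
    case: (ltnP k (2 * i)) => [/bin_small-> | le_k]; first by rewrite !(mul0n, muln0).
    case: (ltnP (n - k) (2 * l)) => [/bin_small-> | le_l]; first by rewrite !(mul0n, muln0).
    rewrite (_ : n - (2 * i + 2 * l) = k - 2 * i + (n - k - 2 * l)); last by lia.
    by rewrite expnD; ring.
  rewrite exchange_big; apply: eq_bigr => i _; rewrite exchange_big.
  apply: eq_bigr => l _; rewrite -!big_distrl /= sum_bin_trinomial /g.
  by rewrite (_ : 4 = 2 * 2) // expnMn; ring.
rewrite sum_triangle; last first.
  by move=> i l Hil; rewrite /g bin_small //; lia.
apply: eq_bigr => m _.
transitivity ('C(2 * m, m) * (\sum_(i < m.+1) 'C(m, i) ^ 2) *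
  'C(n, 2 * m) * 4 ^ (n - 2 * m)); last first.
  by rewrite sum_bin_sqr // mulnn.
rewrite big_distrr !big_distrl /=; apply: eq_bigr => -[i lt_i] _ /=.
rewrite /g -mulnDr subnKC //.
have := @bin_tetranomial i (m - i) i (m - i).
rewrite !subnKC // !addnn -!mul2n -!mulnA => E.
transitivity ('C(n, 2 * m) * 4 ^ (n - 2 * m) *
  ('C(2 * m, 2 * i) * ('C(2 * i, i) * 'C(2 * (m - i), m - i)))); first by ring.
by rewrite E; ring.
Qed.

(** A case of the Pfaff-Saalschütz sum. Expanding 'C(n + j, j) as the sum of 'C(n, i) 'C(j, i) and
    summing over j first gives 'C(k, i) 'C(n - i, k); since 'C(n, i) 'C(n - i, k) = 'C(n, k) 'C(n -
    k, i), the sum over i is again Vandermonde. *)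
Lemma bin_sqr_saalschutz (n k K : nat) : k <= n -> n < K ->
  \sum_(j < K) 'C(n + j, j) * ('C(k, j) * 'C(n - k, j)) = 'C(n, k) ^ 2.
Proof.
move=> le_kn lt_nK.
transitivity (\sum_(j < K) \sum_(i < K)
    'C(n, i) * ('C(k, j) * 'C(j, i) * 'C(n - k, j))).
  apply: eq_bigr => -[j lt_j] _ /=.
  have -> : 'C(n + j, j) = \sum_(i < K) 'C(n, i) * 'C(j, i).
    rewrite addnC -[X in 'C(_, X)]addn0 -(@bin_sum_diag j n 0 K) //.
    by apply: eq_bigr => i _; rewrite addn0 mulnC.
  by rewrite big_distrl; apply: eq_bigr => i _ /=; ring.
rewrite exchange_big /=.
transitivity (\sum_(i < K) 'C(n, k) * ('C(k, i) * 'C(n - k, i + 0))); last first.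
  by rewrite -big_distrr /= bin_sum_diag ?subnKC ?addn0 ?mulnn //; lia.
apply: eq_bigr => -[i lt_i] _ /=; rewrite addn0 -big_distrr /=.
case: (ltnP k i) => [lt_ki | le_ik].
  rewrite (bin_small lt_ki) mul0n muln0 big1 ?muln0 // => j _.
  case: (ltnP k j) => [/bin_small-> // | le_jk].
  by rewrite ['C(j, i)]bin_small ?muln0 //; lia.
rewrite (_ : \sum_(j < K) _ = 'C(k, i) * 'C(n - i, k)).
  have := @bin_trinomial n k 0 i isT le_kn.
  rewrite add0n subn0 !bin0 !muln1 => E.
  by rewrite mulnCA -E mulnCA.
apply: etrans (@sum_shift i K (fun j => 'C(k, j) * 'C(j, i) * 'C(n - k, j)) _ _) _.
- exact: ltnW.
- by move=> j /bin_small->; rewrite muln0.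
transitivity (\sum_(t < K - i) 'C(k, i) * ('C(k - i, t) * 'C(n - k, t + i))).
  apply: eq_bigr => -[t lt_t] _ /=; rewrite mulnA; congr (_ * _).
  case: (leqP (t + i) k) => [le_tik | lt_k]; last first.
    by rewrite (bin_small lt_k) ['C(k - i, t)]bin_small ?muln0 //; lia.
  have := @bin_trinomial k (t + i) i 0 (leq_addl _ _) le_tik.
  by rewrite addn0 bin0 !muln1 binn muln1 addnK.
rewrite -big_distrr bin_sum_diag /=; last by lia.
by rewrite subnK // addnC addnBA // subnK.
Qed.

(** Only two of the three factors 'C(n, k) are expanded, by [bin_sqr_saalschutz]; the third provides
    the weight for [sum_bin_trinomial] with a = b = j. *)
Lemma franel_formula (n : nat) :
  franel n = \sum_(m < n.+1) 'C(n + m, m) * 'C(2 * m, m) * 'C(n, 2 * m) * 2 ^ (n - 2 * m).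
Proof.
rewrite /franel big_mkord.
transitivity (\sum_(k < n.+1) \sum_(j < n.+1)
   'C(n + j, j) * ('C(n, k) * ('C(k, j) * 'C(n - k, j)))).
  apply: eq_bigr => -[k lt_k] _ /=; rewrite expnS -(@bin_sqr_saalschutz n k n.+1) //.
  by rewrite big_distrr /=; apply: eq_bigr => j _; rewrite mulnCA.
rewrite exchange_big; apply: eq_bigr => j _; rewrite -big_distrr sum_bin_trinomial.
by rewrite addnn -mul2n /=; ring.
Qed.

(** * Divisibility by powers of p among p-integral rationals *)

Local Open Scope ring_scope.

(* x lies in p ^ e Z_(p), where Z_(p) is the localization of Z at p. *)
Definition pdvd (p e : nat) (x : rat) :=
  exists b : nat, exists a : int,
    coprime p b /\ x * b%:R = (p ^ e)%:R * a%:~R.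

Lemma pdvd_add p e x y : pdvd p e x -> pdvd p e y -> pdvd p e (x + y).
Proof.
move=> [b [a [cb Hx]]] [c [d [cc Hy]]].
exists (b * c)%N, (a * c%:Z + d * b%:Z); split; first by rewrite coprimeMr cb.
rewrite natrM !rmorphD !rmorphM /= -!pmulrn.
have -> : (x + y) * (b%:R * c%:R) = (x * b%:R) * c%:R + (y * c%:R) * b%:R by ring.
rewrite Hx Hy; ring.
Qed.

Lemma pdvd_mul p e f x y :
  pdvd p e x -> pdvd p f y -> pdvd p (e + f) (x * y).
Proof.
move=> [b [a [cb Hx]]] [c [d [cc Hy]]].
exists (b * c)%N, (a * d); split; first by rewrite coprimeMr cb.
rewrite natrM rmorphM /= expnD natrM.
have -> : (x * y) * (b%:R * c%:R) = (x * b%:R) * (y * c%:R) by ring.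
rewrite Hx Hy; ring.
Qed.

Lemma pdvd_int p (a : int) : pdvd p 0 a%:~R.
Proof. by exists 1%N, a; rewrite coprimen1 mulr1 expn0 mul1r. Qed.

Lemma pdvd_nat p n : pdvd p 0 n%:R.
Proof. exact: (pdvd_int p n). Qed.

Lemma pdvd_expn p e : pdvd p e (p ^ e)%:R.
Proof. by exists 1%N, 1; rewrite coprimen1. Qed.

Lemma pdvd0 p e : pdvd p e 0.
Proof. by exists 1%N, 0; rewrite coprimen1 mul0r mulr0. Qed.

Lemma pdvdMl p e x y : pdvd p 0 x -> pdvd p e y -> pdvd p e (x * y).
Proof. exact: pdvd_mul. Qed.

Lemma pdvdMr p e x y : pdvd p e x -> pdvd p 0 y -> pdvd p e (x * y).
Proof. by rewrite mulrC => ? ?; apply: pdvdMl. Qed.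

Lemma pdvd_opp p e x : pdvd p e x -> pdvd p e (- x).
Proof. by move=> Hx; rewrite -mulN1r; apply: pdvdMl => //; apply: (pdvd_int p (-1)). Qed.

Lemma pdvd_sub p e x y : pdvd p e x -> pdvd p e y -> pdvd p e (x - y).
Proof. by move=> Hx Hy; apply: pdvd_add => //; apply: pdvd_opp. Qed.

Lemma pdvd_le p e f x : (f <= e)%N -> pdvd p e x -> pdvd p f x.
Proof.
move=> le_fe [b [a [cb Hx]]]; exists b, ((p ^ (e - f))%:Z * a); split=> //.
by rewrite Hx -(subnKC le_fe) expnD natrM rmorphM /= -pmulrn addKn mulrA.
Qed.

Lemma pdvd_sum p e (I : Type) (r : seq I) (P : pred I) (F : I -> rat) :
  (forall i, P i -> pdvd p e (F i)) -> pdvd p e (\sum_(i <- r | P i) F i).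
Proof. by move=> H; apply: big_ind => //; [exact: pdvd0 | exact: pdvd_add]. Qed.

Lemma pdvd_inv p (b : nat) : coprime p b -> pdvd p 0 b%:R^-1.
Proof.
(* [b] = 0 is coprime to [p] when [p] = 1; the inverse of 0 is then 0 by convention. *)
move=> cb; case: (eqVneq b 0%N) => [-> | b0]; first by rewrite invr0; apply: pdvd0.
by exists b, 1; rewrite mulVf ?pnatr_eq0 // mulr1.
Qed.

Lemma pdvd_invz p (x : int) : coprime p `|x| -> pdvd p 0 x%:~R^-1.
Proof.
case: x => n cn; first by exact: (@pdvd_inv p n).
by rewrite NegzE rmorphN invrN; apply: pdvd_opp; apply: (@pdvd_inv p n.+1).
Qed.

Lemma pdvd_natP p e n : pdvd p e n%:R -> (p ^ e %| n)%N.
Proof.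
move=> [b [a [cb H]]].
have Hz : (n * b)%:Z = (p ^ e)%:Z * a.
  by apply: (@intr_inj rat); rewrite [RHS]rmorphM -!pmulrn natrM.
have : (p ^ e %| n * b)%N.
  by rewrite -[(n * b)%N]/(`|(n * b)%:Z|)%N Hz abszM dvdn_mulr.
by rewrite Gauss_dvdl // coprimeXl.
Qed.

(** * The hypergeometric sum w and its closed form *)

(* The terminating series 3F2(1/2, -M, M+1; 1, 1; 1). *)
Definition whipple_term (M : rat) (k : nat) : rat :=
  \prod_(i < k) ((i%:R + 2^-1) * (i%:R - M) * (i%:R + M + 1) / (i%:R + 1) ^+ 3).

Definition whipple_sum (M : nat) : rat := \sum_(k < M.+1) whipple_term M%:R k.

Lemma whipple_termS M k : whipple_term M k.+1 = whipple_term M k *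
  ((k%:R + 2^-1) * (k%:R - M) * (k%:R + M + 1) / (k%:R + 1) ^+ 3).
Proof. by rewrite /whipple_term big_ord_recr. Qed.

Lemma whipple_term_gt (M k : nat) : (M < k)%N -> whipple_term M%:R k = 0.
Proof.
by move=> ltMk; rewrite /whipple_term (bigD1 (Ordinal ltMk)) //= subrr; ring.
Qed.

Lemma whipple_sum_widen (M K : nat) : (M < K)%N ->
  \sum_(k < K) whipple_term M%:R k = whipple_sum M.
Proof.
move=> ltMK; rewrite /whipple_sum (big_ord_widen _ (whipple_term M%:R) ltMK).
rewrite [RHS]big_mkcond; apply: eq_bigr => k _ /=.
by case: ltnP => // /whipple_term_gt ->.
Qed.

Lemma natS_neq0 (k : nat) : k%:R + 1 != 0 :> rat.
Proof. by rewrite natr1 pnatr_eq0. Qed.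

(* Zeilberger's algorithm: writing b k for the common factor of the k-th terms
   at M and M + 2, the certificate is G k = - 2 (2 M + 3) k ^ 3 b k. *)
Lemma whipple_sum_rec (M : nat) :
  (M%:R + 2) ^+ 2 * whipple_sum M.+2 = (M%:R + 1) ^+ 2 * whipple_sum M.
Proof.
pose m : rat := M%:R.
pose b (k : nat) : rat := ((m + 1) * (m + 2))^-1 * \prod_(i < k)
  ((i%:R + 2^-1) * (i%:R - m - 2) * (i%:R + m + 1) / (i%:R + 1) ^+ 3).
have bS k : b k.+1 = b k *
  ((k%:R + 2^-1) * (k%:R - m - 2) * (k%:R + m + 1) / (k%:R + 1) ^+ 3).
  by rewrite /b big_ord_recr mulrA.
have m1 : m + 1 != 0 by apply: natS_neq0.
have m2 : m + 2 != 0 by rewrite -natrD pnatr_eq0 addn2.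
have t0 k : whipple_term m k = b k * ((m + 1 - k%:R) * (m + 2 - k%:R)).
  elim: k => [|k IH]; first (rewrite /whipple_term /b !big_ord0; field; by rewrite m2 m1).
  rewrite whipple_termS IH bS -natr1; field; exact: natS_neq0.
have t2 k : whipple_term (m + 2) k = b k * ((m + k%:R + 1) * (m + k%:R + 2)).
  elim: k => [|k IH]; first (rewrite /whipple_term /b !big_ord0; field; by rewrite m2 m1).
  rewrite whipple_termS IH bS -natr1; field; exact: natS_neq0.
pose G (k : nat) : rat := - 2 * (2 * m + 3) * k%:R ^+ 3 * b k.
have GS k : (m + 2) ^+ 2 * whipple_term (m + 2) k
    - (m + 1) ^+ 2 * whipple_term m k = G k.+1 - G k.
  rewrite t0 t2 /G bS -natr1; field; exact: natS_neq0.
have tele K : \sum_(k < K) ((m + 2) ^+ 2 * whipple_term (m + 2) k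
    - (m + 1) ^+ 2 * whipple_term m k) = G K.
  elim: K => [|K IH]; first by rewrite big_ord0 /G; ring.
  by rewrite big_ord_recr IH GS /=; ring.
have := tele M.+3; rewrite big_split /= sumrN -!mulr_sumr.
(* The last factor of [b] M.+3 contains k - m - 2 at k = M + 2, which is zero. *)
have -> : G M.+3 = 0.
  rewrite /G bS.
  have -> : M.+2%:R = m + 2 :> rat by rewrite -addn2 natrD.
  ring.
have EM : M.+2%:R = m + 2 by rewrite -addn2 natrD.
rewrite -EM (whipple_sum_widen M.+2) // (whipple_sum_widen M) //; last by lia.
by move/eqP; rewrite subr_eq0 EM => /eqP.
Qed.

(** The two-step recurrence propagates the value 1 - 1 = 0 at M = 1. *)
Lemma whipple_sum_odd (m : nat) : whipple_sum m.*2.+1 = 0.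
Proof.
elim: m => [|m IH].
  by rewrite double0 /whipple_sum /whipple_term !big_ord_recr !big_ord0 /=; field.
have := whipple_sum_rec m.*2.+1; rewrite IH mulr0 => /eqP.
by rewrite mulf_eq0 sqrf_eq0 -natrD pnatr_eq0 addn2 /= => /eqP.
Qed.

Lemma mul_central_bin (k : nat) :
  (k.+1 * 'C(2 * k.+1, k.+1) = 2 * (2 * k + 1) * 'C(2 * k, k))%N.
Proof.
have H1 := mul_bin_diag (2 * k).+2 k; have H2 := mul_bin_down (2 * k).+1 k.
rewrite (_ : 2 * k.+1 = (2 * k).+2)%N; last by lia.
rewrite -H1 /= (_ : (2 * k).+2 = 2 * k.+1)%N; last by lia.
rewrite (_ : k.+1 = (2 * k).+1 - k)%N; last by lia.
by rewrite -mulnA -H2 addn1 mulnA.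
Qed.

Lemma natr_central_bin (k : nat) :
  (k%:R + 1) * 'C(2 * k.+1, k.+1)%:R = 2 * (2 * k%:R + 1) * 'C(2 * k, k)%:R :> rat.
Proof. by rewrite natr1 -natrM mul_central_bin !natrM natrD natrM. Qed.

Lemma whipple_sum_even (m : nat) :
  whipple_sum m.*2 = ('C(2 * m, m)%:R / 4 ^+ m) ^+ 2.
Proof.
elim: m => [|m IH].
  by rewrite double0 /whipple_sum /whipple_term !big_ord_recr !big_ord0 /= expr0 muln0 bin0; field.
have := whipple_sum_rec m.*2; rewrite IH -mul2n natrM => H.
have m1 := natS_neq0 m.
have -> : 'C(2 * m.+1, m.+1)%:R = 2 * (2 * m%:R + 1) * 'C(2 * m, m)%:R / (m%:R + 1) :> rat.
  by rewrite -natr_central_bin mulrAC mulfV ?mul1r.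
have m2 : 2 * m%:R + 2 != 0 :> rat by rewrite -natrM -natrD pnatr_eq0 addn2.
rewrite doubleS -mul2n; apply: (mulfI (expf_neq0 2 m2)).
rewrite H (exprS 4 m).
field; rewrite m1 /=.
by rewrite expf_neq0.
Qed.

(** * The terms shared by all three sums *)

(* The k-th term of S (2 N) / 4 ^ (2 N).  When 4 N + 1 = p ^ 2, - N and 1/2 - N
   are congruent to 1/4 and 3/4 modulo p ^ 2. *)
Definition common_term (N k : nat) : rat :=
  \prod_(i < k) ((i%:R + 2^-1) * (i%:R - N%:R) * (i%:R - N%:R + 2^-1) / (i%:R + 1) ^+ 3).

Lemma common_termS N k : common_term N k.+1 = common_term N k *
  ((k%:R + 2^-1) * (k%:R - N%:R) * (k%:R - N%:R + 2^-1) / (k%:R + 1) ^+ 3).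
Proof. by rewrite /common_term big_ord_recr. Qed.

Lemma natr_bin_left (n m : nat) :
  (m%:R + 1) * 'C(n, m.+1)%:R = (n%:R - m%:R) * 'C(n, m)%:R :> rat.
Proof.
case: (leqP m n) => [le_mn | lt_nm]; last first.
  by rewrite !bin_small ?mulr0 // ltnW.
by rewrite -natrB // -!natrM -mul_bin_left natrM -natr1.
Qed.

(** The denominator is only a power of 2, so the terms are p-integral for odd p even though k!^3
    occurs in the product. *)
Lemma common_termE N k :
  common_term N k = 'C(2 * k, k)%:R ^+ 2 * 'C(2 * N, 2 * k)%:R / 16 ^+ k.
Proof.
elim: k => [|k IH]; first by rewrite /common_term big_ord0 muln0 !bin0 expr0; field.
have k1 := natS_neq0 k.
have k2 : 2 * k%:R + 1 != 0 :> rat by rewrite -natrM; apply: natS_neq0.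
have -> : 'C(2 * k.+1, k.+1)%:R = 2 * (2 * k%:R + 1) * 'C(2 * k, k)%:R / (k%:R + 1) :> rat.
  by rewrite -natr_central_bin mulrAC mulfV ?mul1r.
have H1 := natr_bin_left (2 * N) (2 * k); have H2 := natr_bin_left (2 * N) (2 * k).+1.
have -> : 'C(2 * N, 2 * k.+1)%:R = (2 * N%:R - 2 * k%:R - 1) / (2 * k%:R + 2) *
    ((2 * N%:R - 2 * k%:R) / (2 * k%:R + 1) * 'C(2 * N, 2 * k)%:R) :> rat.
  rewrite (_ : 2 * k.+1 = (2 * k).+2)%N; last by rewrite mulnS.
  have k3 : 2 * k%:R + 2 != 0 :> rat by rewrite -natrM -natrD pnatr_eq0 addn2.
  apply: (mulfI k3).
  rewrite -natr1 natrM in H2; rewrite natrM in H1.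
  rewrite (_ : 2 * k%:R + 2 = 2%:R * k%:R + 1 + 1); last by ring.
  rewrite H2.
  apply: (mulfI k2); rewrite mulrCA H1 natrM.
  field; rewrite k2 (_ : 2 * k%:R + 1 + 1 = 2%:R * k%:R + 2) //; by ring.
rewrite common_termS IH (exprS 16 k).
field; rewrite k1 k2 expf_neq0 //=.
by rewrite -natrM -natrD pnatr_eq0 addn2.
Qed.

Lemma coprime_pow2 p e : prime p -> odd p -> coprime p (2 ^ e).
Proof.
move=> pp op; rewrite coprimeXr // prime_coprime // dvdn_prime2 //.
by apply/eqP=> E; rewrite E in op.
Qed.

Lemma common_term_int p N k : prime p -> odd p -> pdvd p 0 (common_term N k).
Proof.
move=> pp op; rewrite common_termE -natrX -natrM -natrX.
apply: pdvdMl; first exact: pdvd_nat.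
by apply: pdvd_inv; rewrite -[16%N]/(2 ^ 4)%N -expnM; apply: coprime_pow2.
Qed.

Lemma common_term_gt N k : (N < k)%N -> common_term N k = 0.
Proof.
by move=> lt; rewrite /common_term (bigD1 (Ordinal lt)) //= subrr; ring.
Qed.

Ltac pdvd0_closed := lazymatch goal with
  | |- pdvd _ _ (_ + _) => apply: pdvd_add; pdvd0_closed
  | |- pdvd _ _ (- _) => apply: pdvd_opp; pdvd0_closed
  | |- pdvd _ _ (_ * _) => apply: pdvdMl; pdvd0_closed
  | |- pdvd _ _ 1 => exact: (pdvd_nat _ 1)
  | |- pdvd _ _ _%:R => exact: pdvd_nat
  | |- _ => assumption
  end.

(** * Congruences between the three sums modulo p and p^2 *)

Section Congruences.
Variables (p N M : nat).
Hypotheses (pp : prime p) (op : odd p).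
Hypothesis defN : (4 * N + 1 = p ^ 2)%N.
Hypothesis dvdM : (p %| (4 * M + 1) * (4 * M + 3))%N.

Lemma coprime_mod u r : (0 < r < p)%N -> coprime p (p * u + r).
Proof.
move=> /andP[r0 rp]; rewrite prime_coprime // dvdn_addr ?dvdn_mulr //.
by apply/negP => /(dvdn_leq r0); rewrite leqNgt rp.
Qed.

(** Modulo p, each of the pairs (-N, 1/2 - N) and (-M, M + 1) consists of 1/4 and 3/4 in some order,
    by [defN] and [dvdM]. The bound on r keeps both denominators prime to p. *)
Lemma ratio_congr (u r : nat) : (r.+1 < p)%N ->
  let i : rat := (p * u + r)%:R in
  pdvd p 1 ((i + 2^-1) * (i - N%:R) * (i - N%:R + 2^-1) / (i + 1) ^+ 3
    - (r%:R + 2^-1) * (r%:R - M%:R) * (r%:R + M%:R + 1) / (r%:R + 1) ^+ 3).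
Proof.
move=> ltr i.
case/dvdnP: dvdM => c Ec.
pose P : rat := p%:R; pose x : rat := r%:R; pose U : rat := u%:R.
have EN : N%:R = (P ^+ 2 - 1) / 4 :> rat.
  by rewrite /P -natrX -defN natrD natrM; field.
have EM : (4 * M%:R + 1) * (4 * M%:R + 3) = c%:R * P :> rat.
  by have := congr1 (fun n => n%:R : rat) Ec; rewrite /= !(natrM, natrD).
have Ei : i = P * U + x by rewrite /i natrD natrM.
have d1 : i + 1 != 0 by apply: natS_neq0.
have d2 : x + 1 != 0 by apply: natS_neq0.
have Di : pdvd p 0 (i + 1)^-1.
  by rewrite natr1; apply: pdvd_inv; rewrite -addnS coprime_mod.
have Dx : pdvd p 0 (x + 1)^-1.
  by rewrite natr1; apply: pdvd_inv; rewrite -[r.+1]add0n -(muln0 p) coprime_mod.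
have D32 : pdvd p 0 32^-1 by apply: (@pdvd_inv p 32); apply: (@coprime_pow2 p 5).
(* The difference is exhibited as p R with R p-integral. [B] is 32 times the numerator at r, and Q +
   (2x + 1) c is the difference of the two numerators, times 32 and divided by p. The second part of
   [R] comes from b^3 - a^3 = (b - a)(a^2 + a b + b^2) and b - a = p u a b. *)
pose Q := 2 * U * (4 * i + 1 - P * P) * (4 * i + 3 - P * P)
  + (2 * x + 1) * (4 * U - P) * (4 * i + 3 - P * P)
  + (2 * x + 1) * (4 * x + 1) * (4 * U - P).
pose B := (2 * x + 1) * (4 * x - 4 * M%:R) * (4 * x + 4 * M%:R + 4).
pose a := (i + 1)^-1; pose b := (x + 1)^-1.
pose R := 32^-1 * (a * (a * (a * (Q + (2 * x + 1) * c%:R))))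
  - 32^-1 * (B * (U * (a * (b * (b * b)) + a * (a * (b * b)) + a * (a * (a * b))))).
rewrite [X in pdvd _ _ X](_ : _ = P * R).
  apply: pdvdMr; first by rewrite /P -[p in p%:R]expn1; apply: pdvd_expn.
  have [iP iU ix ii] : [/\ pdvd p 0 P, pdvd p 0 U, pdvd p 0 x & pdvd p 0 i].
    by split; apply: pdvd_nat.
  by rewrite /R /Q /B; pdvd0_closed.
have EPU : P * U = i - x by rewrite Ei addrK.
have EPQ : P * Q + (2 * x + 1) * (c%:R * P) =
    32 * ((i + 2^-1) * (i - N%:R) * (i - N%:R + 2^-1)) - B.
  by rewrite -EM EN /Q /B Ei; field.
have -> : P * R = 32^-1 * (a ^+ 3 * (P * Q + (2 * x + 1) * (c%:R * P)))
  - 32^-1 * (B * ((P * U) * (a * b ^+ 3 + a ^+ 2 * b ^+ 2 + a ^+ 3 * b))).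
  by rewrite /R; ring.
rewrite EPQ EPU /B /a /b -/x; field.
by apply/andP; split => //; rewrite -natrM -natrD natS_neq0.
Qed.

(* Lucas-type congruence: modulo p, the block of terms with index in
   [p u, p (u + 1)) is proportional to the terms of the vanishing whipple_sum M. *)
Lemma common_term_congr u r : (r < p)%N ->
  pdvd p 1 (common_term N (p * u + r) - common_term N (p * u) * whipple_term M%:R r).
Proof.
elim: r => [_|r IH ltr].
  by rewrite addn0 /whipple_term big_ord0 mulr1 subrr; apply: pdvd0.
have {}IH := IH (ltnW ltr); have /= Hr := ratio_congr u r ltr.
rewrite addnS common_termS whipple_termS.
set s := common_term N _ in IH *; set s0 := common_term N _ in IH *.
set t := whipple_term _ _ in IH *.
set rho := (X in s * X); set tau := (X in t * X).
have -> : s * rho - s0 * (t * tau) = (s - s0 * t) * tau + s * (rho - tau) by ring.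
apply: pdvd_add; last by apply: pdvdMl Hr; apply: common_term_int.
apply: pdvdMr => //; rewrite /tau.
have D2 : pdvd p 0 2^-1 by apply: (@pdvd_inv p 2); apply: (@coprime_pow2 p 1).
have Dx : pdvd p 0 (r%:R + 1)^-1.
  by rewrite natr1; apply: pdvd_inv; rewrite -[r.+1]add0n -(muln0 p) coprime_mod.
rewrite !exprS expr0 mulr1 !invfM; pdvd0_closed.
Qed.

Hypotheses (oddM : odd M) (ltMp : (2 * M < p)%N).

(** The prefix consists of u full blocks and a partial one that reaches index M. As [whipple_term]
    vanishes beyond M, every one of them is modulo p a multiple of the whole [whipple_sum M], zero
    for odd M. *)
Lemma common_prefix_dvd u r : (M <= r < p)%N ->
  pdvd p 1 (\sum_(k < p * u + r.+1) common_term N k).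
Proof.
have block v q : (M <= q < p)%N -> pdvd p 1 (\sum_(i < q.+1) common_term N (p * v + i)).
  move=> /andP[leM ltq].
  rewrite (_ : \sum_(i < q.+1) _ = \sum_(i < q.+1) (common_term N (p * v + i) -
    common_term N (p * v) * whipple_term M%:R i)).
    apply: pdvd_sum => -[i lti] _; apply: common_term_congr.
    exact: leq_ltn_trans ltq.
  rewrite sumrB -mulr_sumr whipple_sum_widen ?ltnS // -(odd_double_half M) oddM.
  by rewrite whipple_sum_odd mulr0 subr0.
have split_sum v m : \sum_(k < v + m) common_term N k =
    \sum_(k < v) common_term N k + \sum_(k < m) common_term N (v + k).
  by rewrite big_split_ord.
move=> Hr; rewrite split_sum; apply: pdvd_add; last exact: block.
have p0 := prime_gt0 pp.
elim: u => [|u IH]; first by rewrite muln0 big_ord0; apply: pdvd0.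
rewrite mulnS addnC split_sum; apply: pdvd_add; first exact: IH.
have := block u p.-1; rewrite prednK //; apply; lia.
Qed.

Lemma common_sum_dvd : pdvd p 1 (\sum_(k < N.+1) common_term N k).
Proof.
have p0 := prime_gt0 pp.
have ltM : (M <= p.-1 < p)%N by lia.
(* p full blocks cover all indices up to N, and the terms beyond N are zero. *)
have := common_prefix_dvd p.-1 p.-1 ltM.
rewrite prednK // -mulnSr prednK //.
have le : (N.+1 <= p * p)%N by nia.
rewrite (big_ord_widen _ (common_term N) le) [X in _ -> pdvd _ _ X]big_mkcond.
move=> H; rewrite (eq_bigr (fun k : 'I_(p * p) => common_term N k)) // => k _.
by case: ltnP => // /common_term_gt->.
Qed.

Lemma summation_by_parts (s y : nat -> rat) n :
  \sum_(k < n.+1) s k * (\sum_(j < k) y j) =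
  (\sum_(k < n.+1) s k) * (\sum_(j < n) y j)
   - \sum_(j < n) (\sum_(k < j.+1) s k) * y j.
Proof.
elim: n => [|n IH]; first by rewrite !big_ord_recr !big_ord0 /=; ring.
rewrite big_ord_recr IH [X in _ = X * _ - _]big_ord_recr /=.
by rewrite ![\sum_(j < n.+1) _ * y j]big_ord_recr [\sum_(j < n.+1) y j]big_ord_recr /=; ring.
Qed.

Lemma prod1D_congr (y : nat -> rat) k : (forall j, (j < k)%N -> pdvd p 1 (y j)) ->
  pdvd p 1 (\sum_(j < k) y j) /\
  pdvd p 2 (\prod_(j < k) (1 + y j) - 1 - \sum_(j < k) y j).
Proof.
elim: k => [|k IH] Hy.
  by rewrite !big_ord0 !subrr; split; apply: pdvd0.
have [j ltj|IH1 IH2] := IH; first exact/Hy/ltnW.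
have yk : pdvd p 1 (y k) by exact: Hy.
rewrite !big_ord_recr /=; split; first exact: pdvd_add.
set Q := \prod_(_ < _) _ in IH2 *; set s := \sum_(_ < _) _ in IH1 IH2 *.
have -> : Q * (1 + y k) - 1 - (s + y k) = (Q - 1 - s) * (1 + y k) + s * y k by ring.
apply: pdvd_add; last exact: (@pdvd_mul _ 1 1).
apply: pdvdMr => //; apply: pdvd_add; first exact: (pdvd_nat _ 1).
exact: pdvd_le yk.
Qed.

(* To first order in y the difference is a combination of the y j with
   coefficients that are differences of prefix sums of common_term, and these
   are divisible by p at the indices where y j is not divisible by p ^ 2. *)
Lemma perturbed_sum_congr (y : nat -> rat) :
  (forall j, (j < N)%N -> pdvd p 1 (y j) /\ (pdvd p 2 (y j) \/ (M <= j %% p)%N)) ->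
  pdvd p 2 (\sum_(k < N.+1) common_term N k * \prod_(j < k) (1 + y j)
    - \sum_(k < N.+1) common_term N k).
Proof.
move=> Hy.
have p0 := prime_gt0 pp.
rewrite (_ : _ - _ = \sum_(k < N.+1) common_term N k *
    (\prod_(j < k) (1 + y j) - 1 - \sum_(j < k) y j)
  + \sum_(k < N.+1) common_term N k * \sum_(j < k) y j); last first.
  by rewrite -sumrB -big_split; apply: eq_bigr => k _ /=; ring.
have Hy1 k : (k <= N)%N -> forall j, (j < k)%N -> pdvd p 1 (y j).
  by move=> lek j ltj; have [|] := Hy j => //; apply: leq_trans lek.
apply: pdvd_add.
  apply: pdvd_sum => -[k ltk] _ /=; apply: pdvdMl; first exact: common_term_int.
  by have [] := prod1D_congr _ _ (Hy1 k ltk).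
rewrite summation_by_parts; apply: pdvd_sub.
  apply: (@pdvd_mul _ 1 1); first exact: common_sum_dvd.
  by have [] := prod1D_congr _ _ (Hy1 N (leqnn N)).
apply: pdvd_sum => -[j ltj] _ /=.
have [y1 [y2 | leM]] := Hy j ltj.
  by apply: pdvdMl => //; apply: pdvd_sum => k _; apply: common_term_int.
apply: (@pdvd_mul _ 1 1) => //.
have := common_prefix_dvd (j %/ p) (j %% p); rewrite addnS mulnC -divn_eq.
by apply; rewrite leM ltn_pmod.
Qed.

(** If x = t p or x = - t p, the size bound forces 0 < t < p, so the quotient is p / t up to sign
    with t prime to p. *)
Lemma pdvd_sqr_div (x : int) : (0 < `|x| < p ^ 2)%N ->
  pdvd p 1 ((p ^ 2)%:R / x%:~R) /\ (~~ (p %| `|x|)%N -> pdvd p 2 ((p ^ 2)%:R / x%:~R)).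
Proof.
move=> /andP[x0 xp].
have copr : ~~ (p %| `|x|)%N -> pdvd p 2 ((p ^ 2)%:R / x%:~R).
  move=> npx; apply: pdvdMr; first exact: pdvd_expn.
  by apply: pdvd_invz; rewrite prime_coprime.
split=> //; have [/dvdnP[t Et] | /copr] := boolP (p %| `|x|)%N; last exact: pdvd_le.
have t0 : (0 < t)%N by move: x0; rewrite Et muln_gt0 => /andP[].
have ltp : (t < p)%N by move: xp; rewrite Et expnS expn1 ltn_pmul2r // prime_gt0.
have p0 : p%:R != 0 :> rat by rewrite pnatr_eq0 -lt0n prime_gt0.
have t0' : t%:R != 0 :> rat by rewrite pnatr_eq0 -lt0n.
have Dt : pdvd p 0 t%:R^-1.
  by apply: pdvd_inv; rewrite -[t]add0n -(muln0 p) coprime_mod // t0.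
have P1 : pdvd p 1 p%:R by rewrite -[p in p%:R]expn1; apply: pdvd_expn.
have [Ex|Ex] : x = (t * p)%:Z \/ x = - (t * p)%:Z by lia.
  rewrite Ex -pmulrn (_ : _ / _ = p%:R * t%:R^-1); first exact: pdvdMr.
  by rewrite natrX natrM; field; rewrite ?p0 ?t0'.
rewrite Ex rmorphN /= -pmulrn (_ : _ / _ = - (p%:R * t%:R^-1)); first exact/pdvd_opp/pdvdMr.
by rewrite natrX natrM; field; rewrite ?p0 ?t0'.
Qed.

Hypothesis leM : forall r, (r < p)%N -> (p %| 4 * r + 3)%N -> (M <= r)%N.

Lemma dvdn_mod_l a b j : (p %| a * j + b)%N -> (p %| a * (j %% p) + b)%N.
Proof.
move=> H; rewrite /dvdn -modnDml modnMmr modnDml; exact: H.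
Qed.

(** Since p^2 = 4N + 1, one has j + N + 1 = (j - N + 1/2)(1 + p^2/(2j + 1 - 2N)). Moreover 2(2j + 1
    - 2N) = 4j + 3 - p^2, so p divides this denominator only if p divides 4j + 3, the case governed
    by [leM]. *)
Lemma whipple_sum_congr :
  pdvd p 2 (whipple_sum N - \sum_(k < N.+1) common_term N k).
Proof.
have p0 := prime_gt0 pp.
pose y (j : nat) : rat := (p ^ 2)%:R / ((2 * j + 1)%:Z - (2 * N)%:Z)%:~R.
have EN : (p ^ 2)%:R = 4 * N%:R + 1 :> rat by rewrite -defN natrD natrM.
rewrite (_ : whipple_sum N = \sum_(k < N.+1) common_term N k * \prod_(j < k) (1 + y j)).
  apply: perturbed_sum_congr => j ltj.
  have [|D1 D2] := @pdvd_sqr_div ((2 * j + 1)%:Z - (2 * N)%:Z); first by lia.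
  split=> //; case: (boolP (p %| 4 * j + 3)%N) => [dj|ndj].
    by right; apply: leM; [rewrite ltn_pmod | apply: dvdn_mod_l].
  left; apply: D2; apply: contra ndj => dj.
  have E : (2 * `|((2 * j + 1)%:Z - (2 * N)%:Z)| + (4 * j + 3) = p ^ 2)%N by lia.
  have : (p %| p ^ 2)%N by rewrite expnS dvdn_mulr.
  by rewrite -E dvdn_addr // dvdn_mull.
apply: eq_bigr => k _.
elim: (k : nat) => [|i IH]; first by rewrite /whipple_term /common_term !big_ord0 mulr1.
rewrite whipple_termS common_termS big_ord_recr /= IH /y rmorphB /= -!pmulrn EN natrD !natrM.
have i1 := natS_neq0 i.
have D : 2 * i%:R + 1 - 2 * N%:R != 0 :> rat.
  rewrite -!natrM natr1 subr_eq0 eqr_nat; lia.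
by field; rewrite ?i1 ?D.
Qed.

(** Here 2N + j + 1 = (j + 1/2)(1 + p^2/(2j + 1)), which turns 'C(2N + k, k) into 'C(2k, k) / 4^k
    times the perturbing product. If p divides 2j + 1, then j mod p is at least (p - 1)/2, hence at
    least M. *)
Lemma franel_sum_congr :
  pdvd p 2 (\sum_(k < N.+1) 'C(2 * N + k, k)%:R * 'C(2 * k, k)%:R * 'C(2 * N, 2 * k)%:R / 4 ^+ k
   - \sum_(k < N.+1) common_term N k).
Proof.
have p0 := prime_gt0 pp.
pose y (j : nat) : rat := (p ^ 2)%:R / (2 * j + 1)%:Z%:~R.
have EN : (p ^ 2)%:R = 4 * N%:R + 1 :> rat by rewrite -defN natrD natrM.
rewrite (_ : \sum_(k < N.+1) _ = \sum_(k < N.+1) common_term N k * \prod_(j < k) (1 + y j)).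
  apply: perturbed_sum_congr => j ltj.
  have [|D1 D2] := @pdvd_sqr_div (2 * j + 1)%:Z; first by lia.
  split=> //; case: (boolP (p %| 2 * j + 1)%N) => [dj|ndj]; last by left; apply: D2.
  right; have := @dvdn_mod_l _ _ _ dj.
  by rewrite addn1 => /(dvdn_leq (ltn0Sn _)); move: (j %% p)%N => r; lia.
apply: eq_bigr => k _.
rewrite common_termE.
have E m : 'C(2 * N + m, m)%:R = 'C(2 * m, m)%:R * \prod_(j < m) (1 + y j) / 4 ^+ m :> rat.
  elim: m => [|m IH]; first by rewrite big_ord0 muln0 !bin0 expr0; field.
  have m1 := natS_neq0 m.
  have m2 : 2 * m%:R + 1 != 0 :> rat by rewrite -natrM; apply: natS_neq0.
  apply: (mulfI m1).
  have -> : (m%:R + 1) * 'C(2 * N + m.+1, m.+1)%:R =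
      (2 * N%:R + m%:R + 1) * 'C(2 * N + m, m)%:R :> rat.
    by rewrite addnS natr1 -natrM -mul_bin_diag natrM -natr1 natrD natrM.
  rewrite IH big_ord_recr exprS /= [RHS]mulrA [X in _ = X / _]mulrA natr_central_bin.
  set Q := \prod_(_ < _) _; rewrite /y -pmulrn EN natrD natrM.
  by field; rewrite expf_neq0.
rewrite E (_ : 16 = 4 * 4 :> rat); last by ring.
rewrite exprMn.
set Q := \prod_(_ < _) _.
by field; rewrite expf_neq0.
Qed.

End Congruences.

(** * Divisibility of the closed form and conclusion *)

(** Doubling p u + r produces a carry at the last base-p digit. In the induction, the factor p
    enters as 2(p u + r) + 1 = p(2u + 1) at r = (p - 1)/2, and the later divisors p u + r + 1 are
    prime to p. *)
Lemma central_bin_dvd (p u r : nat) : prime p -> odd p ->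
  (p./2 < r < p)%N -> (p %| 'C(2 * (p * u + r), p * u + r))%N.
Proof.
move=> pp op.
elim: r => [|r IH] /andP[lth ltp]; first by [].
have cop : coprime p (p * u + r).+1 by rewrite -addnS; apply: coprime_mod.
rewrite addnS -(Gauss_dvdr _ cop) mul_central_bin.
have [lt_r|/eqP Er] : (p./2 < r)%N \/ (p./2 == r)%N by lia.
  by apply/dvdn_mull/IH; lia.
apply/dvdn_mulr/dvdn_mull/dvdnP; exists (2 * u + 1)%N.
by have := odd_double_half p; rewrite op Er -mul2n; nia.
Qed.

Lemma natr_S N :
  (S (2 * N))%:R = 4 ^+ (2 * N) * \sum_(k < N.+1) common_term N k :> rat.
Proof.
rewrite S_formula (@sum_truncate N.+1 _
  (fun m => ('C(2 * m, m) ^ 2 * 'C(2 * N, 2 * m) * 4 ^ (2 * N - 2 * m))%N)).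
- rewrite natr_sum mulr_sumr; apply: eq_bigr => -[k lt_k] _ /=.
  rewrite common_termE !natrM !natrX.
  have -> : 4 ^+ (2 * N) = 4 ^+ (2 * N - 2 * k) * 16 ^+ k :> rat.
    rewrite (_ : 16 = 4 ^+ 2 :> rat); last by ring.
    by rewrite -exprM -exprD subnK //; lia.
  by field; rewrite expf_neq0.
- lia.
- by move=> i Hi; rewrite ['C(2 * N, _)]bin_small ?muln0 //; lia.
Qed.

Lemma natr_franel N : (franel (2 * N))%:R = 4 ^+ N *
  \sum_(k < N.+1) 'C(2 * N + k, k)%:R * 'C(2 * k, k)%:R * 'C(2 * N, 2 * k)%:R / 4 ^+ k :> rat.
Proof.
rewrite franel_formula (@sum_truncate N.+1 _
  (fun m => ('C(2 * N + m, m) * 'C(2 * m, m) * 'C(2 * N, 2 * m) * 2 ^ (2 * N - 2 * m))%N)).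
- rewrite natr_sum mulr_sumr; apply: eq_bigr => -[k lt_k] _ /=.
  rewrite !natrM -mulnBr expnM natrX.
  have -> : 4 ^+ N = 4 ^+ (N - k) * 4 ^+ k :> rat by rewrite -exprD subnK.
  by field; rewrite expf_neq0.
- lia.
- by move=> i Hi; rewrite ['C(2 * N, _)]bin_small ?muln0 //; lia.
Qed.

Lemma S_franel_dvd (p u r M : nat) : prime p -> odd p ->
  (8 * (p * u + r) + 1 = p ^ 2)%N -> (p./2 < r < p)%N ->
  odd M -> (2 * M < p)%N -> (p %| (4 * M + 1) * (4 * M + 3))%N ->
  (forall i, (i < p)%N -> (p %| 4 * i + 3)%N -> (M <= i)%N) ->
  (p ^ 2 %| S (2 * (2 * (p * u + r))))%N /\ (p ^ 2 %| franel (2 * (2 * (p * u + r))))%N.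
Proof.
move=> pp op Ep Hr oddM ltM dvdM leM; set N := (2 * (p * u + r))%N.
have EN : (4 * N + 1 = p ^ 2)%N by rewrite -Ep /N; lia.
have W : pdvd p 2 (whipple_sum N).
  rewrite /N mul2n whipple_sum_even.
  have D : pdvd p 1 ('C(2 * (p * u + r), p * u + r)%:R / 4 ^+ (p * u + r)).
    have /dvdnP[c ->] := central_bin_dvd p u r pp op Hr.
    rewrite -natrX natrM; apply: pdvdMr.
      by apply: pdvdMl; [exact: pdvd_nat | rewrite -[X in X%:R]expn1; exact: pdvd_expn].
    by apply: pdvd_inv; rewrite -[4%N]/(2 ^ 2)%N -expnM; apply: coprime_pow2.
  by rewrite expr2; apply: (@pdvd_mul _ 1 1).
have C0 : pdvd p 2 (\sum_(k < N.+1) common_term N k).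
  have := pdvd_sub _ _ _ _ W (@whipple_sum_congr p N M pp op EN dvdM oddM ltM leM).
  by rewrite subKr.
have F0 := pdvd_add _ _ _ _ (@franel_sum_congr p N M pp op EN dvdM oddM ltM) C0.
rewrite subrK in F0.
split; apply: pdvd_natP.
  by rewrite natr_S -natrX; apply: pdvdMl; first exact: pdvd_nat.
by rewrite natr_franel -natrX; apply: pdvdMl; first exact: pdvd_nat.
Qed.

Close Scope ring_scope.

Theorem theorem3p5 (p : nat) (hp : prime p)
  (hmod : (p %% 8 == 5) || (p %% 8 == 7)) :
  (p ^ 2 %| S ((p ^ 2 - 1) %/ 2)) && (p ^ 2 %| franel ((p ^ 2 - 1) %/ 2)).
Proof.
have op : odd p by case/orP: hmod; lia.
pose v := p %/ 8.
(* With p = 8v + s, p^2 = 8 p v + s p, so r = (s p - 1)/8. This exceeds p/2 for s = 5, 7; for s = 1,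
   3 it would not. *)
have [r [Ep Hr]] : exists r, 8 * (p * v + r) + 1 = p ^ 2 /\ p./2 < r < p.
  case/orP: hmod => /eqP Hp.
    have Ev : p = 8 * v + 5 by rewrite [LHS](divn_eq p 8) Hp mulnC.
    by exists (5 * v + 3); split; [rewrite [in LHS]Ev [in RHS]Ev; ring | lia].
  have Ev : p = 8 * v + 7 by rewrite [LHS](divn_eq p 8) Hp mulnC.
  by exists (7 * v + 6); split; [rewrite [in LHS]Ev [in RHS]Ev; ring | lia].
have -> : (p ^ 2 - 1) %/ 2 = 2 * (2 * (p * v + r)).
  by rewrite -Ep addnK (_ : 8 * _ = 2 * (2 * (p * v + r)) * 2) ?mulnK //; ring.
(* M = 2v + 1 is floor(p/4): p equals 4M + 1 or 4M + 3 according to its residue modulo 8. *)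
apply/andP; apply: (@S_franel_dvd p v r (2 * v + 1)) => //.
- lia.
- by case/orP: hmod => /eqP; lia.
- case/orP: hmod => /eqP Hp.
    by apply/dvdn_mulr; rewrite (_ : _ + 1 = p) // [RHS](divn_eq p 8) Hp /v; lia.
  by apply/dvdn_mull; rewrite (_ : _ + 3 = p) // [RHS](divn_eq p 8) Hp /v; lia.
move=> i lt_ip /dvdnP[c Ec].
(* From 4i + 3 = c p < 4p, residues modulo 4 leave c = 3, i = 6v + 3 when p = 8v + 5, and c = 1, i =
   M when p = 8v + 7. *)
have lt_c4 : c < 4 by rewrite -(ltn_pmul2r (prime_gt0 hp)) -Ec; lia.
move: c lt_c4 Ec => [|[|[|[|c]]]] // _ Ec; rewrite /v.
all: by case/orP: hmod => /eqP; lia.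
Qed.
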